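(* Every invitation-promoted monotone (IP-MON) allocation rule $f$ is network-implementable.
   Context: Network auction model. There is a finite set $N$ of bidders and a seller. Bidder $i$ has true type $\theta_i=(v_i,r_i)$, where $v_i\in\mathbb R_{\ge0}$ is her value for winning and $r_i$ is her set of neighbors in the social network. She reports $\theta_i'=(v_i',r_i')\in\Theta_i=\mathbb R_{\ge 0}\times\mathcal P(r_i)$; $\Theta=\times_i\Theta_i$. A mechanism is $\mathcal M=(f,p)$ with $f_i:\Theta\to\{0,1\}$ and $p_i:\Theta\to\mathbb R$; utility is $u_i(\theta')=f_i(\theta')v_i-p_i(\theta')$. $\mathcal M$ is strategyproof if $u_i((v_i,r_i),\theta'_{-i})\ge u_i((v_i',r_i'),\theta'_{-i})$ for all $i$, all true types $(v_i,r_i)$, all $(v_i',r_i')\in\Theta_i$ and all $\theta'_{-i}$. $f$ is network-implementable if there is a payment rule $p$ such that $(f,p)$ is strategyproof. Invitation-promoted order: $(v_i^1,r_i^1)\succeq_{\mathcal P}(v_i^2,r_i^2)$ if $v_i^1\ge v_i^2$ and $r_i^2\subseteq r_i^1$. $f$ is IP-MON if for every $i$ and $\theta_{-i}$, $f_i(\theta_i,\theta_{-i})=1$ implies $f_i(\theta_i',\theta_{-i})=1$ for all $\theta_i'\succeq_{\mathcal P}\theta_i$. *)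

(* Defs.v *)
From HB Require Import structures.
From mathcomp Require Import all_boot all_order all_algebra.
From mathcomp Require Import reals interval_inference.

Set Implicit Arguments.
Unset Strict Implicit.
Unset Printing Implicit Defensive.

Import Order.TTheory GRing.Theory Num.Theory.
Local Open Scope ring_scope.

(* Vertices of the social network: [Some i] is the bidder [i : N], [None] is
   the seller. *)
Definition vertex (N : finType) : finType := option N.

(* [nb i] is the largest neighbour set that bidder [i] can have.  Every subset
   of it is a possible true neighbour set; taking [nb i] to be the actual
   neighbour set gives R>=0 x P(r_i), and taking it to be the whole vertex set
   leaves the true neighbour sets unconstrained. *)
Definition bidder_type (R : realType) (N : finType) (nb : N -> {set vertex N})
    (i : N) : Type :=
  ({nonneg R} * {r : {set vertex N} | r \in powerset (nb i)})%type.

Definition profile (R : realType) (N : finType) (nb : N -> {set vertex N}) :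
    Type :=
  forall i : N, bidder_type R nb i.

Section Auction.
Variables (R : realType) (N : finType) (nb : N -> {set vertex N}).

Definition value (i : N) (t : bidder_type R nb i) : R := t.1%:num.

Definition neighbours (i : N) (t : bidder_type R nb i) : {set vertex N} :=
  val t.2.

Definition allocation_rule : Type := N -> profile R nb -> bool.

Definition payment_rule : Type := N -> profile R nb -> R.

(* The profile (t_i, theta_{-i}); the i-th component of [theta] is ignored. *)
Definition with_report (theta : profile R nb) (i : N) (t : bidder_type R nb i) :
    profile R nb :=
  dfwith theta t.

(* Bidder [i] of true type [t] may report any value, but only a subset of her
   true neighbours. *)
Definition can_report (i : N) (t t' : bidder_type R nb i) : Prop :=
  neighbours t' \in powerset (neighbours t).

Definition utility (f : allocation_rule) (p : payment_rule) (i : N)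
    (t : bidder_type R nb i) (theta : profile R nb) : R :=
  (f i theta)%:R * value t - p i theta.

Definition strategyproof (f : allocation_rule) (p : payment_rule) : Prop :=
  forall (i : N) (t t' : bidder_type R nb i) (theta : profile R nb),
    can_report t t' ->
    utility f p t (with_report theta t) >= utility f p t (with_report theta t').

Definition network_implementable (f : allocation_rule) : Prop :=
  exists p : payment_rule, strategyproof f p.

Definition ip_ge (i : N) (t1 t2 : bidder_type R nb i) : Prop :=
  value t1 >= value t2 /\ neighbours t2 \subset neighbours t1.

Definition ip_mon (f : allocation_rule) : Prop :=
  forall (i : N) (theta : profile R nb) (t : bidder_type R nb i),
    f i (with_report theta t) ->
    forall t' : bidder_type R nb i, ip_ge t' t -> f i (with_report theta t').

End Auction.

(* Main.v *)
Require Import Defs.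
From mathcomp Require Import all_boot all_order all_algebra.
From mathcomp Require Import reals interval_inference.
From mathcomp Require Import boolp classical_sets.

(** Charge a winner the infimum of the values that win with her reported
    neighbour set, and a loser nothing.  By IP-MON this critical value can only
    decrease as the neighbour set grows, so hiding neighbours never lowers the
    price of winning; for a fixed neighbour set it is a posted price, which makes
    reporting the true value optimal. *)

Set Implicit Arguments.
Unset Strict Implicit.
Unset Printing Implicit Defensive.

Import Order.TTheory GRing.Theory Num.Theory.
Local Open Scope classical_set_scope.
Local Open Scope ring_scope.

Section CriticalValue.
Variables (R : realType) (N : finType) (nb : N -> {set vertex N}).
Implicit Types (f : allocation_rule R nb) (theta : profile R nb).

Lemma with_report_idem theta i (t t' : bidder_type R nb i) :
  with_report (with_report theta t) t' = with_report theta t'.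
Proof.
apply: functional_extensionality_dep => j; rewrite /with_report.
by case: dfwithP => [|k ik]; rewrite ?dfwith_in// !dfwith_out.
Qed.

Lemma with_report_in theta i (t : bidder_type R nb i) :
  with_report theta t i = t.
Proof. exact: dfwith_in. Qed.

Definition winning_values f i theta (r : {r | r \in powerset (nb i)}) : set R :=
  [set v%:num | v in [set v : {nonneg R} | f i (with_report theta (v, r))]].

(* If no value wins, [inf set0 = 0] is a junk value; it is never charged. *)
Definition critical_payment f : payment_rule R nb := fun i theta =>
  if f i theta then inf (winning_values f theta (theta i).2) else 0.

Lemma winning_valuesP f i theta (t : bidder_type R nb i) :
  f i (with_report theta t) -> winning_values f theta t.2 (value t).
Proof. by case: t => v r ft; exists v. Qed.

Lemma winning_values_lbound f i theta r :
  has_lbound (@winning_values f i theta r).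
Proof. by exists 0 => _ [v _ <-]. Qed.

(** The report of [i] stored in the profile is overwritten inside [winning_values], so the price of
    winning can depend on her reported neighbours but not on her reported value. *)
Lemma critical_paymentE f i theta (t : bidder_type R nb i) :
  critical_payment f i (with_report theta t) =
  if f i (with_report theta t) then inf (winning_values f theta t.2) else 0.
Proof.
rewrite /critical_payment with_report_in /winning_values.
by under eq_set do rewrite with_report_idem.
Qed.

Lemma winning_values_subset f i theta (t t' : bidder_type R nb i) :
  ip_mon f -> can_report t t' ->
  winning_values f theta t'.2 `<=` winning_values f theta t.2.
Proof.
move=> fmon; rewrite /can_report inE => tt' _ [v fv <-]; exists v => //.
by apply: (fmon _ _ _ fv); split; first exact: lexx.
Qed.

(** A winning value below [value t] would, by IP-MON at the same neighbour set, make [t] win. *)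
Lemma losing_value_lbound f i theta (t : bidder_type R nb i) :
  ip_mon f -> ~~ f i (with_report theta t) ->
  lbound (winning_values f theta t.2) (value t).
Proof.
move=> fmon /negP nft _ [v fv <-]; rewrite leNgt; apply/negP => vt.
by apply: nft; apply: (fmon _ _ _ fv); split; [exact: ltW|exact: subxx].
Qed.

Lemma critical_payment_strategyproof f :
  ip_mon f -> strategyproof f (critical_payment f).
Proof.
move=> fmon i t t' theta tt'; rewrite /utility !critical_paymentE.
have sub := winning_values_subset (theta := theta) fmon tt'.
have lb := @winning_values_lbound f i theta t.2.
have [ft'|_] := boolP (f i (with_report theta t')).
(* Bounding the price at [t'] from below needs a nonempty set, as the infimum of the empty set is
   0. *)
- have ne : winning_values f theta t'.2 !=set0.
    by exists (value t'); exact: winning_valuesP.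
  have [ft|nft] := boolP (f i (with_report theta t)); rewrite !(mul1r, mul0r, subr0).
  + rewrite lerD2l lerN2; apply: lb_le_inf => // x /sub.
    exact: ge_inf.
  (* Truth loses but [t'] wins: [value t] is a lower bound for [t.2], hence for the smaller set at
     [t'.2], so winning costs at least [value t]. *)
  + rewrite subr_le0; apply: lb_le_inf => // x /sub.
    exact: losing_value_lbound.
- rewrite mul0r subrr.
  have [ft|_] := boolP (f i (with_report theta t)).
  (* A truthful winner's value is itself a winning value, so the price does not exceed it. *)
  + by rewrite mul1r subr_ge0; apply: ge_inf => //; exact: winning_valuesP.
  + by rewrite mul0r subrr.
Qed.

End CriticalValue.

Theorem theorem4p3 (R : realType) (N : finType) (nb : N -> {set vertex N})
    (f : allocation_rule R nb) :
  ip_mon f -> network_implementable f.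
Proof.
by move=> fmon; exists (critical_payment f); exact: critical_payment_strategyproof.
Qed.
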